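(* Let $A=(a_{ij})$ be a real (not necessarily symmetric) $n\times n$ matrix with constant row and column sums and a constant diagonal, and let $B=(b_{ij})$ be any real $n\times n$ matrix. Let $f:S_n\to\mathbb{R}$ be defined by $$f(\sigma)=\sum_{i,j=1}^n b_{\sigma(i)\sigma(j)}\,a_{ij},$$ let $\overline f=\frac1{n!}\sum_{\sigma\in S_n}f(\sigma)$ and $f_0=f-\overline f$. Let $\tau\in S_n$ satisfy $f_0(\tau)=\max_{\sigma\in S_n}f_0(\sigma)$. Let $k$ be an integer with $3\le k\le n-5$, let $0<\gamma<1$, and let $$\beta(n,k)=\frac{k^2-3k+1}{n^2-3n+1}.$$ Then the probability that a uniformly random permutation $\sigma\in S_n$ satisfies $$f_0(\sigma)\ge\gamma\,\beta(n,k)\,f_0(\tau)$$ is at least $$\frac{(1-\gamma)\,\beta(n,k)}{10\,k!}.$$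
   Context: $S_n$ is the group of permutations of $\{1,\dots,n\}$. ''Constant row and column sums'' means there is a number $a$ with $\sum_{i}a_{ij}=a$ for all $j$ and $\sum_j a_{ij}=a$ for all $i$; ''constant diagonal'' means there is a number $b$ with $a_{ii}=b$ for all $i$. *)

(* Defs.v *)
From HB Require Import structures.
From mathcomp Require Import all_boot all_order all_fingroup all_algebra.
From mathcomp Require Import reals.

Set Implicit Arguments.
Unset Strict Implicit.
Unset Printing Implicit Defensive.

Import Order.TTheory GRing.Theory Num.Theory.
Local Open Scope ring_scope.

(* Indices and permuted points are 0, ..., n-1 instead of 1, ..., n. *)

Definition constant_line_sums (R : realType) (n : nat) (A : 'M[R]_n) : Prop :=
  exists a : R,
    (forall j : 'I_n, \sum_i A i j = a) /\ (forall i : 'I_n, \sum_j A i j = a).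

Definition constant_diagonal (R : realType) (n : nat) (A : 'M[R]_n) : Prop :=
  exists b : R, forall i : 'I_n, A i i = b.

Definition qap (R : realType) (n : nat) (A B : 'M[R]_n) (s : 'S_n) : R :=
  \sum_(i < n) \sum_(j < n) B (s i) (s j) * A i j.

Definition perm_mean (R : realType) (n : nat) (f : 'S_n -> R) : R :=
  (n`!%:R)^-1 * \sum_(s : 'S_n) f s.

Definition centered (R : realType) (n : nat) (f : 'S_n -> R) (s : 'S_n) : R :=
  f s - perm_mean f.

(* Probability of the event P under the uniform distribution on S_n. *)
Definition perm_prob (R : realType) (n : nat) (P : pred 'S_n) : R :=
  #|[set s : 'S_n | P s]|%:R / #|{: 'S_n}|%:R.

Definition beta (R : realType) (n k : nat) : R :=
  (k%:R ^+ 2 - 3 * k%:R + 1) / (n%:R ^+ 2 - 3 * n%:R + 1).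

(* Main.v *)
(* Replacing A by A - c J - d I only adds a constant to f, so A may be taken with
   zero diagonal and zero line sums, and after relabelling B one may take tau = 1.
   Fix sigma with k fixed points and c points in 2-cycles. The mean of f over the
   conjugacy class of sigma is then a combination, with coefficients affine in c,
   of f(1) and of the value f'(1) obtained by transposing B. Let theta = 1 - beta(n,k).
   If the random number c has mean theta, the coefficient of f'(1) vanishes and that
   of f(1) is exactly beta(n,k). So choose c = 0 with probability 1 - theta/2 and
   c = 2 with probability theta/2, then a uniform permutation with k fixed points
   and c points in 2-cycles. At least a tenth of all permutations of j >= 3 points
   have no cycle of length 1 or 2; hence this measure has density at most 10 k!
   with respect to the uniform one, and a Markov-type estimate concludes. *)
Require Import Defs.
From HB Require Import structures.
From mathcomp Require Import all_boot all_order all_fingroup all_algebra.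
From mathcomp Require Import reals.
From mathcomp Require Import zify ring lra.

Set Implicit Arguments.
Unset Strict Implicit.
Unset Printing Implicit Defensive.

Import Order.TTheory GRing.Theory Num.Theory.
Local Open Scope ring_scope.

(** * Lower bounds for the number of permutations with prescribed fixed points and 2-cycles *)

Section CycleCounts.
Local Open Scope nat_scope.
Variable T : finType.
Implicit Types (s t : {perm T}) (S K P : {set T}) (x y z : T).

Definition fixed_points s : {set T} := [set x | s x == x].

Definition two_cycle_points s : {set T} := [set x | (s x != x) && (s (s x) == x)].

(** All cycles inside [S] have length at least 3. Being the identity off [S] keeps all subsets in
    one type, so a permutation of a smaller set is extended by multiplication. *)
Definition long_cycles_on S : {set {perm T}} :=
  [set s | (fixed_points s == ~: S) && (two_cycle_points s == set0)].

Lemma long_cycles_onP S s :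
  reflect (forall x, if x \in S then s x != x /\ s (s x) != x else s x = x)
          (s \in long_cycles_on S).
Proof.
rewrite inE; apply: (iffP andP) => [[/eqP/setP F /eqP/setP C] x | H].
  move: (F x) (C x); rewrite !inE.
  by case: (x \in S) => /= [-> /= ->//|/eqP].
by split; apply/eqP/setP => x; rewrite !inE; move: (H x); case: (x \in S) => /=;
  do [case=> /negbTE a /negbTE b; rewrite ?a ?b ?andbF | move->; rewrite eqxx].
Qed.

Lemma sum_card_fibers_le (U I : finType) (D : {set U}) (h : U -> I) (p : pred I) :
  \sum_(i | p i) #|[set u in D | h u == i]| <= #|D|.
Proof.
rewrite -[X in _ <= X]sum1_card (bigID (fun u => p (h u))) /=.
rewrite (partition_big h p) /=; last by move=> u /andP[].
apply: leq_trans (leq_addr _ _); apply: leq_sum => i pi.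
rewrite -sum1_card (eq_bigl (fun u => (u \in D) && p (h u) && (h u == i))) // => u.
by rewrite inE; case: eqP => [->|]; rewrite ?pi ?andbT ?andbF.
Qed.

Lemma card_mulr_le (D E : {set {perm T}}) (c : {perm T}) :
  {in D, forall s, (s * c)%g \in E} -> #|D| <= #|E|.
Proof.
move=> H; rewrite -(card_imset (mem D) (mulIg c)); apply: subset_leq_card.
by apply/subsetP => _ /imsetP[s sD ->]; apply: H.
Qed.

(** The transposition inserts [x], a fixed point of [s], just before [y] in a cycle of length at
    least 3, so the new cycle has length at least 4. *)
Lemma long_cycles_insert S x y s : x \in S -> y \in S :\ x ->
  s \in long_cycles_on (S :\ x) ->
  let t := (s * tperm x y)%g in
  [/\ t \in long_cycles_on S, t x = y & t (t (t x)) != x].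
Proof.
move=> xS; rewrite !in_setD1 => /andP[yx yS] /long_cycles_onP H t.
have sx : s x = x by have := H x; rewrite !inE eqxx.
have [sy ssy] : s y != y /\ s (s y) != y by have := H y; rewrite !inE yx yS.
have tE z : t z = tperm x y (s z) by rewrite permM.
have sxN z : z != x -> s z != x by rewrite -{2}sx (inj_eq perm_inj).
have tx : t x = y by rewrite tE sx tpermL.
have tD z : s z != y -> z != x -> t z = s z.
  by move=> a b; rewrite tE tpermD // eq_sym ?sxN.
have ty : t y = s y by rewrite tD.
have tsy : t (s y) = s (s y) by rewrite tD ?sxN.
split=> //; last by rewrite tx ty tsy !sxN.
apply/long_cycles_onP => z; case: (eqVneq z x) => [->|zx].
  by rewrite xS tx ty sxN.
have := H z; rewrite !inE zx /=.
case: (eqVneq (s z) y) => [szy|szy].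
  have zy : z != y by apply: contraNneq sy => E; rewrite -{1}E szy.
  have tz : t z = x by rewrite tE szy tpermR.
  case: (z \in S) => [_|E]; last by rewrite -E szy eqxx in zy.
  by rewrite tz tx eq_sym zx eq_sym zy.
case: (z \in S) => [[a b]|E]; last by rewrite tD.
rewrite tD //; split=> //; rewrite tE; case: (eqVneq (s (s z)) y) => [->|n].
  by rewrite tpermR eq_sym.
by rewrite tpermD // eq_sym // !sxN.
Qed.

(** The factor [tperm x y * tperm x z] is the 3-cycle (x y z), disjoint from the support of [s]. *)
Lemma long_cycles_add_3cycle S x y z s : x \in S -> y \in S :\ x ->
  z \in S :\ x :\ y -> s \in long_cycles_on (S :\ x :\ y :\ z) ->
  let t := (s * (tperm x y * tperm x z))%g in
  [/\ t \in long_cycles_on S, t x = y, t y = z & t z = x].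
Proof.
move=> xS; rewrite !in_setD1 => /andP[yx yS] /and3P[zy zx zS] /long_cycles_onP H t.
have [sx sy sz] : [/\ s x = x, s y = y & s z = z].
  by have := (H x, H y, H z); rewrite !inE !eqxx !andbF /= => -[[-> ->] ->].
have sN u v : s v = v -> u != v -> s u != v by move=> {2}<-; rewrite (inj_eq perm_inj).
have tE u : t u = tperm x z (tperm x y (s u)) by rewrite !permM.
have tx : t x = y by rewrite tE sx tpermL tpermD // eq_sym.
have ty : t y = z by rewrite tE sy tpermR tpermL.
have tz : t z = x by rewrite tE sz (tpermD (z := z)) ?tpermR // eq_sym.
split=> //; apply/long_cycles_onP => w.
case: (eqVneq w x) => [->|wx]; first by rewrite xS tx ty.
case: (eqVneq w y) => [->|wy]; first by rewrite yS ty tz [x == y]eq_sym.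
case: (eqVneq w z) => [->|wz]; first by rewrite zS tz tx eq_sym [y == z]eq_sym.
have tD u : u != x -> u != y -> u != z -> t u = s u.
  by move=> a b c; rewrite tE !(@tpermD _ _ _ (s u)) // eq_sym sN.
have := H w; rewrite !inE wx wy wz /= tD //.
case: (w \in S) => // -[a b]; split=> //.
by rewrite tD // sN.
Qed.

Lemma long_cycles_add_2cycle S x y s : x \in S -> y \in S :\ x ->
  s \in long_cycles_on (S :\: [set x; y]) ->
  let t := (s * tperm x y)%g in
  fixed_points t = ~: S /\ two_cycle_points t = [set x; y].
Proof.
move=> xS; rewrite !in_setD1 => /andP[yx yS] /long_cycles_onP H t.
have [sx sy] : s x = x /\ s y = y.
  by have := (H x, H y); rewrite !inE !eqxx !orbT /= => -[-> ->].
have sN u v : s v = v -> u != v -> s u != v by move=> {2}<-; rewrite (inj_eq perm_inj).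
have tE u : t u = tperm x y (s u) by rewrite !permM.
have tx : t x = y by rewrite tE sx tpermL.
have ty : t y = x by rewrite tE sy tpermR.
have tD u : u != x -> u != y -> t u = s u.
  by move=> a b; rewrite tE !(@tpermD _ _ _ (s u)) // eq_sym sN.
suff W w : (t w == w) = (w \notin S) /\ ((t w != w) && (t (t w) == w)) = (w \in [set x; y]).
  by split; apply/setP => w; have [] := W w; rewrite !inE.
rewrite !inE; case: (eqVneq w x) => [->|wx]; first by rewrite xS tx ty yx eqxx (negbTE yx).
case: (eqVneq w y) => [->|wy]; first by rewrite yS ty tx eqxx eq_sym (negbTE yx).
have := H w; rewrite !inE (negbTE wx) (negbTE wy) /= tD //.
case: (w \in S) => [[/negbTE a /negbTE b]|E]; last by rewrite E eqxx.
by rewrite a tD ?b // sN.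
Qed.

(* Reading a permutation with x deleted from its cycle (y being the image of x)
   counts those where the cycle of x has length at least 4; the second sum counts
   those where it is (x y z). *)
Lemma card_long_cycles_rec S x : x \in S ->
  \sum_(y in S :\ x) #|long_cycles_on (S :\ x)| +
  \sum_(y in S :\ x) \sum_(z in S :\ x :\ y) #|long_cycles_on (S :\ x :\ y :\ z)|
  <= #|long_cycles_on S|.
Proof.
move=> xS; set D := long_cycles_on S.
rewrite -(cardsID [set t : {perm T} | t (t (t x)) == x] D) addnC leq_add //.
  rewrite pair_big_dep /=.
  apply: leq_trans (sum_card_fibers_le _ (fun t => (t x, t (t x))) _).
  apply: leq_sum => -[y z] /= /andP[yS zS].
  apply: (card_mulr_le (c := (tperm x y * tperm x z)%g)) => s sD.
  have [tS tx ty tz] := long_cycles_add_3cycle xS yS zS sD.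
  by rewrite in_set in_setI tS in_set tx ty tz !eqxx.
apply: leq_trans (sum_card_fibers_le _ (fun t => t x) _).
apply: leq_sum => y yS; apply: (card_mulr_le (c := tperm x y)) => s sD.
have [tS tx tttx] := long_cycles_insert xS yS sD.
by rewrite in_set in_setD tS in_set tttx tx eqxx.
Qed.

Lemma card_long_cycles_set0 : 0 < #|long_cycles_on set0|.
Proof.
apply/card_gt0P; exists 1%g; apply/long_cycles_onP => w.
by rewrite inE perm1.
Qed.

Lemma cardsD1_pred S x : x \in S -> #|S :\ x| = #|S|.-1.
Proof. by move=> xS; rewrite [#|S|](cardsD1 x) xS. Qed.

(** Inserting a point gains the factor [#|S|.-1]; on three points only the second sum of the
    recursion counts, and it yields the two 3-cycles. *)
Lemma card_long_cycles_ge_pred S : 2 < #|S| -> (#|S|.-1)`! <= #|long_cycles_on S|.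
Proof.
have [m] := ubnP #|S|; elim: m S => // m IH S Sm S3.
have [x xS] : exists x, x \in S by apply/card_gt0P; lia.
have Sx := cardsD1_pred xS; apply: leq_trans (card_long_cycles_rec xS).
have [S4|S4] := leqP 4 #|S|.
  apply: leq_trans (leq_addr _ _); rewrite sum_nat_const.
  have := IH (S :\ x); rewrite Sx => h1.
  apply: leq_trans (leq_mul (leqnn _) (h1 _ _)); try lia.
  by case: (#|S|) S4 => [|[|n]] //= _; rewrite factS.
have S3' : #|S| = 3 by lia.
apply: leq_trans (leq_addl _ _).
have -> : (#|S|.-1)`! = \sum_(y in S :\ x) \sum_(z in S :\ x :\ y) 1.
  rewrite (eq_bigr (fun=> 1)) => [|y yS]; first by rewrite sum1_card Sx S3'.
  by rewrite sum1_card cardsD1_pred // Sx S3'.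
apply: leq_sum => y yS; apply: leq_sum => z zS.
suff -> : S :\ x :\ y :\ z = set0 by exact: card_long_cycles_set0.
by apply/cards0_eq; rewrite !cardsD1_pred // S3'.
Qed.

(** Factorials satisfy the recursion with equality, m! = (m-1)(m-1)! + (m-1)(m-2)(m-3)!, so the
    factor 10 is inherited once m - 3 >= 3. For 3 <= m <= 5 the bound (m-1)! suffices, since m <=
    10. *)
Lemma card_long_cycles_ge S : 2 < #|S| -> #|S|`! <= 10 * #|long_cycles_on S|.
Proof.
have [m] := ubnP #|S|; elim: m S => // m IH S Sm S3.
have [S6|S6] := leqP 6 #|S|; last first.
  apply: leq_trans (leq_mul (leqnn 10) (card_long_cycles_ge_pred S3)).
  by case: (#|S|) S6 S3 => // n S6 _; rewrite factS leq_mul //; lia.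
have [x xS] : exists x, x \in S by apply/card_gt0P; lia.
have Sx := cardsD1_pred xS.
apply: leq_trans (leq_mul (leqnn 10) (card_long_cycles_rec xS)).
rewrite mulnDr.
have h1 : #|S|.-1 * (#|S|.-1)`! <= 10 * \sum_(y in S :\ x) #|long_cycles_on (S :\ x)|.
  by rewrite sum_nat_const mulnCA -Sx leq_mul2l IH ?orbT // Sx; lia.
have h3 : #|S|.-1 * (#|S|.-2 * (#|S| - 3)`!) <= 10 *
    \sum_(y in S :\ x) \sum_(z in S :\ x :\ y) #|long_cycles_on (S :\ x :\ y :\ z)|.
  rewrite -{1}Sx -sum_nat_const big_distrr leq_sum //= => y yS.
  rewrite -Sx -(cardsD1_pred yS) -sum_nat_const big_distrr leq_sum //= => z zS.
  have Sz : #|S :\ x :\ y :\ z| = #|S| - 3 by rewrite !cardsD1_pred //; lia.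
  by rewrite -Sz IH // Sz; lia.
apply: leq_trans (leq_add h1 h3).
case: (#|S|) S6 => [|[|[|n]]] //= _.
by rewrite !subSS !subn0 !factS; nia.
Qed.

(** A union of conjugacy classes. Here [c] counts points, so it is twice the number of 2-cycles. *)
Definition cycle_class k c : {set {perm T}} :=
  [set s | (#|fixed_points s| == k) && (#|two_cycle_points s| == c)].

(** [P] is to carry the only 2-cycle. Its choice accounts for m! = 2 binom(m,2) (m-2)!, and at least
    3 points remain for long cycles, at the cost of the factor 10. *)
Lemma card_long_cycles_draws S : 4 < #|S| ->
  #|S|`! <= 20 * \sum_(P : {set T} | (P \subset S) && (#|P| == 2)) #|long_cycles_on (S :\: P)|.
Proof.
move=> S5.
have -> : #|S|`! = 2 * \sum_(P : {set T} | (P \subset S) && (#|P| == 2)) (#|S| - 2)`!.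
  rewrite sum_nat_const -(bin_fact (n := #|S|) (m := 2)) ?(leq_trans _ S5) //.
  rewrite -cards_draws mulnCA [2`!]/=; congr (_ * (_ * _)).
  by apply: eq_card => P; rewrite inE.
rewrite -[20]/(2 * 10) -mulnA leq_mul2l /= big_distrr leq_sum //= => P /andP[PS /eqP P2].
have SP : #|S :\: P| = #|S| - 2 by rewrite cardsD (setIidPr PS) P2.
by rewrite -SP card_long_cycles_ge // SP; lia.
Qed.

(** Split by the fixed set [K]: n! = k! binom(n,k) (n-k)!, and the complement of [K] carries long
    cycles only. *)
Lemma card_cycle_class0_ge k : k + 5 <= #|T| -> #|T|`! <= 10 * k`! * #|cycle_class k 0|.
Proof.
move=> kT.
have -> : #|T|`! = k`! * \sum_(K : {set T} | (K \subset setT) && (#|K| == k)) (#|T| - k)`!.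
  rewrite sum_nat_const -(bin_fact (n := #|T|) (m := k)); last lia.
  by rewrite -cardsT -cards_draws mulnCA; congr (_ * (_ * _)); apply: eq_card => P; rewrite inE.
rewrite [10 * _]mulnC -mulnA leq_mul2l; apply/orP; right.
apply: leq_trans (leq_mul (leqnn 10) (sum_card_fibers_le _ fixed_points _)).
rewrite big_distrr; apply: leq_sum => K /andP[_ /eqP Kk].
have CK : #|~: K| = #|T| - k by rewrite cardsCs setCK Kk.
rewrite -CK; apply: leq_trans (card_long_cycles_ge _) _; first by rewrite CK; lia.
rewrite leq_mul2l /=; apply: subset_leq_card; apply/subsetP => s; rewrite !inE setCK.
by move=> /andP[/eqP-> /eqP->]; rewrite Kk cards0 !eqxx.
Qed.

(** Choose the fixed set, then the pair forming the 2-cycle. The constant 20 is affordable because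
    this class gets weight at most 1/2 in the mixture. *)
Lemma card_cycle_class2_ge k : k + 5 <= #|T| -> #|T|`! <= 20 * k`! * #|cycle_class k 2|.
Proof.
move=> kT.
have -> : #|T|`! = k`! * \sum_(K : {set T} | (K \subset setT) && (#|K| == k)) (#|T| - k)`!.
  rewrite sum_nat_const -(bin_fact (n := #|T|) (m := k)); last lia.
  by rewrite -cardsT -cards_draws mulnCA; congr (_ * (_ * _)); apply: eq_card => P; rewrite inE.
rewrite [20 * _]mulnC -mulnA leq_mul2l; apply/orP; right.
apply: leq_trans (leq_mul (leqnn 20) (sum_card_fibers_le _ fixed_points _)).
rewrite big_distrr; apply: leq_sum => K /andP[_ /eqP Kk].
have CK : #|~: K| = #|T| - k by rewrite cardsCs setCK Kk.
rewrite -CK; apply: leq_trans (card_long_cycles_draws _) _; first by rewrite CK; lia.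
rewrite leq_mul2l /=;
  apply: leq_trans (sum_card_fibers_le _ two_cycle_points
    (fun P => (P \subset ~: K) && (#|P| == 2))).
apply: leq_sum => P /andP[PK P2]; have /cards2P[x [y [xy PE]]] := P2.
have xK : x \in ~: K by apply: (subsetP PK); rewrite PE !inE eqxx.
have yK : y \in ~: K :\ x by rewrite in_setD1 eq_sym xy (subsetP PK) // PE !inE eqxx orbT.
apply: (card_mulr_le (c := tperm x y)) => s; rewrite PE => sD.
have [] := long_cycles_add_2cycle xK yK sD; rewrite setCK => F C.
by rewrite !in_set F C Kk -PE !eqxx P2.
Qed.

Lemma cycle_classJ k c s t : ((s ^ t)%g \in cycle_class k c) = (s \in cycle_class k c).
Proof.
have F : fixed_points (s ^ t)%g = t @: fixed_points s.
  apply/setP => x; rewrite -[x](permKV t) (mem_imset _ _ perm_inj) !inE permJ.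
  by rewrite (inj_eq perm_inj).
have C : two_cycle_points (s ^ t)%g = t @: two_cycle_points s.
  apply/setP => x; rewrite -[x](permKV t) (mem_imset _ _ perm_inj) !inE !permJ.
  by rewrite !(inj_eq perm_inj).
by rewrite !in_set F C !card_imset //; apply: perm_inj.
Qed.

End CycleCounts.

(** * Means of f over conjugacy classes, for A with zero diagonal and zero line sums *)

Section Symmetrization.
Variables (R : realType) (n : nat) (A B : 'M[R]_n).
Hypotheses (A_diag : forall i, A i i = 0) (A_row : forall i, \sum_j A i j = 0)
  (A_col : forall j, \sum_i A i j = 0).
Implicit Types (i j p q : 'I_n) (r s : 'S_n).

Definition sym_sum i j p q := \sum_(r : 'S_n) B (r p) (r q) * A (r i) (r j).

(** By this invariance [sym_sum] depends only on which of its four arguments coincide. *)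
Lemma sym_sum_perm s i j p q : sym_sum (s i) (s j) (s p) (s q) = sym_sum i j p q.
Proof.
rewrite /sym_sum [RHS](reindex_inj (mulgI s)) /=.
by apply: eq_bigr => r _; rewrite !permM.
Qed.

Lemma sym_sum_diag i p q : sym_sum i i p q = 0.
Proof. by rewrite /sym_sum big1 // => r _; rewrite A_diag mulr0. Qed.

Lemma sym_sum_row i p q : \sum_j sym_sum i j p q = 0.
Proof.
rewrite exchange_big big1 //= => r _; rewrite -mulr_sumr.
have <- : \sum_j A (r i) j = \sum_j A (r i) (r j) by exact: (reindex_inj perm_inj).
by rewrite A_row mulr0.
Qed.

Lemma sym_sum_col j p q : \sum_i sym_sum i j p q = 0.
Proof.
rewrite exchange_big big1 //= => r _; rewrite -mulr_sumr.
have <- : \sum_i A i (r j) = \sum_i A (r i) (r j) by exact: (reindex_inj perm_inj).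
by rewrite A_col mulr0.
Qed.

Lemma sym_sum_row_const i p q j j' :
  j != i -> j != p -> j != q -> j' != i -> j' != p -> j' != q ->
  sym_sum i j p q = sym_sum i j' p q.
Proof.
move=> ji jp jq ji' jp' jq'; rewrite -(sym_sum_perm (tperm j j')) tpermL.
by rewrite !tpermD.
Qed.

Lemma sym_sum_col_const j p q i i' :
  i != j -> i != p -> i != q -> i' != j -> i' != p -> i' != q ->
  sym_sum i j p q = sym_sum i' j p q.
Proof.
move=> ji jp jq ji' jp' jq'; rewrite -(sym_sum_perm (tperm i i')) tpermL.
by rewrite !tpermD.
Qed.

Lemma two_transitive i j p q : i != j -> p != q -> exists s, s i = p /\ s j = q.
Proof.
move=> ij pq; exists (tperm i p * tperm (tperm i p j) q)%g.
have jp : tperm i p j != p by rewrite -[X in _ != X](tpermL i p) (inj_eq perm_inj) eq_sym.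
by rewrite !permM !tpermL; split=> //; rewrite (tpermD jp) // eq_sym.
Qed.

Lemma sum_const_off (P : {set 'I_n}) (F : 'I_n -> R) c :
  (forall i, i \notin P -> F i = c) ->
  \sum_i F i = \sum_(i in P) F i + (n%:R - #|P|%:R) * c.
Proof.
move=> H; rewrite (bigID (mem P)) /=; congr (_ + _).
rewrite (eq_bigr _ H) sumr_const -[X in _ *+ X]/#|[predC P]|.
have := cardC (mem P); rewrite card_ord => /(congr1 (fun m => m%:R : R)).
rewrite natrD => <-; rewrite -mulr_natl; ring.
Qed.

Variables i0 j0 : 'I_n.
Hypothesis ij0 : i0 != j0.
(** Up to the factor n!/(n(n-1)), these two numbers are f(1) and its analogue for B transposed;
    2-transitivity makes the choice of pair irrelevant. *)
Definition same_sum := sym_sum i0 j0 i0 j0.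
Definition swap_sum := sym_sum i0 j0 j0 i0.

Lemma sym_sum_eq i j : i != j -> sym_sum i j i j = same_sum.
Proof. by move=> ij; have [s [<- <-]] := two_transitive ij0 ij; apply: sym_sum_perm. Qed.

Lemma sym_sum_swap i j : i != j -> sym_sum i j j i = swap_sum.
Proof. by move=> ij; have [s [<- <-]] := two_transitive ij0 ij; apply: sym_sum_perm. Qed.

(** In a vanishing row sum the diagonal entry is 0, one entry is [same_sum], and the other n-2
    agree. The next three lemmas repeat this with columns or with [swap_sum]. *)
Lemma sym_sum_keep_left i j q : i != j -> q != i -> q != j ->
  (n%:R - 2) * sym_sum i j i q = - same_sum.
Proof.
move=> ij qi qj; have := sym_sum_row i i q.
rewrite (@sum_const_off [set i; q] _ (sym_sum i j i q)) => [|j'].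
  rewrite cards2 eq_sym qi big_setU1 ?inE 1?eq_sym // big_set1 sym_sum_diag sym_sum_eq 1?eq_sym //.
  by move=> /= ?; lra.
rewrite !inE negb_or => /andP[a b].
by apply: sym_sum_row_const => //; rewrite eq_sym.
Qed.

Lemma sym_sum_keep_right i j p : i != j -> p != i -> p != j ->
  (n%:R - 2) * sym_sum i j p j = - same_sum.
Proof.
move=> ij qi qj; have := sym_sum_col j p j.
rewrite (@sum_const_off [set j; p] _ (sym_sum i j p j)) => [|j'].
  rewrite cards2 eq_sym qj big_setU1 ?inE 1?eq_sym // big_set1 sym_sum_diag sym_sum_eq //.
  by move=> /= ?; lra.
rewrite !inE negb_or => /andP[a b].
by apply: sym_sum_col_const => //; rewrite eq_sym.
Qed.

Lemma sym_sum_shift_left i j q : i != j -> q != i -> q != j ->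
  (n%:R - 2) * sym_sum i j j q = - swap_sum.
Proof.
move=> ij qi qj; have := sym_sum_col j j q.
rewrite (@sum_const_off [set j; q] _ (sym_sum i j j q)) => [|j'].
  rewrite cards2 eq_sym qj big_setU1 ?inE 1?eq_sym // big_set1 sym_sum_diag sym_sum_swap //.
  by move=> /= ?; lra.
rewrite !inE negb_or => /andP[a b].
by apply: sym_sum_col_const => //; rewrite eq_sym.
Qed.

Lemma sym_sum_shift_right i j p : i != j -> p != i -> p != j ->
  (n%:R - 2) * sym_sum i j p i = - swap_sum.
Proof.
move=> ij qi qj; have := sym_sum_row i p i.
rewrite (@sum_const_off [set i; p] _ (sym_sum i j p i)) => [|j'].
  rewrite cards2 eq_sym qi big_setU1 ?inE 1?eq_sym // big_set1 sym_sum_diag sym_sum_swap 1?eq_sym //.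
  by move=> /= ?; lra.
rewrite !inE negb_or => /andP[a b].
by apply: sym_sum_row_const => //; rewrite eq_sym.
Qed.

(** Now the row has two special entries, already known, besides the zero on the diagonal; the
    remaining n-3 agree. *)
Lemma sym_sum_generic i j p q : i != j -> p != q -> p != i -> p != j -> q != i -> q != j ->
  (n%:R - 2) * ((n%:R - 3) * sym_sum i j p q) = same_sum + swap_sum.
Proof.
move=> ij pq pi pj qi qj; have := sym_sum_row i p q.
rewrite (@sum_const_off [set i; p; q] _ (sym_sum i j p q)) => [|j'].
  have iN : i \notin [set p; q] by rewrite !inE negb_or ![i == _]eq_sym pi.
  rewrite -setUA cardsU1 iN cards2 pq big_setU1 //= big_setU1 ?inE // big_set1 sym_sum_diag.
  move/(congr1 (fun x => (n%:R - 2) * x)); rewrite add0r mulr0 !mulrDr.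
  rewrite sym_sum_shift_left ?sym_sum_keep_right // 1?eq_sym //.
  by move=> /= ?; lra.
rewrite !inE !negb_or => /andP[/andP[a b] c].
by apply: sym_sum_row_const => //; rewrite eq_sym.
Qed.

(* A single bilinear formula covering all coincidence patterns: since i <> j and
   p <> q, the products u*s, u*t, v*s and v*t all vanish. *)
Lemma sym_sumE i j p q : i != j -> p != q ->
  let N : R := n%:R ^+ 2 - 3 * n%:R + 1 in
  let u : R := (p == i)%:R in let v : R := (q == j)%:R in
  let s : R := (p == j)%:R in let t : R := (q == i)%:R in
  (n%:R - 2) * ((n%:R - 3) * sym_sum i j p q) =
  same_sum * (N * (u * v) - (n%:R - 2) * (u + v) - (s + t) + s * t + 1) +
  swap_sum * (N * (s * t) - (n%:R - 2) * (s + t) - (u + v) + u * v + 1).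
Proof.
move=> ij pq N.
case: (eqVneq p i) pq => [->|pi] pq; [rewrite (negbTE ij) ![q == i]eq_sym (negbTE pq) | ].
  case: (eqVneq q j) pq => [->|qj] pq /=.
    by rewrite sym_sum_eq // /N; ring.
  rewrite mulrCA sym_sum_keep_left // 1?eq_sym // /N; ring.
case: (eqVneq q j) pq => [->|qj] pq.
  rewrite (negbTE pq) ![j == i]eq_sym (negbTE ij) /=.
  rewrite mulrCA sym_sum_keep_right // /N; ring.
case: (eqVneq p j) pq pi => [->|pj] pq pi; case: (eqVneq q i) pq qj => [->|qi] pq qj /=.
- by rewrite sym_sum_swap // /N; ring.
- rewrite mulrCA sym_sum_shift_left // 1?eq_sym // /N; ring.
- rewrite mulrCA sym_sum_shift_right // /N; ring.
- rewrite sym_sum_generic // /N; ring.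
Qed.

Lemma sum_qap_conj s :
  \sum_(r : 'S_n) qap A B (s ^ r)%g = \sum_i \sum_j sym_sum i j (s i) (s j).
Proof.
under eq_bigr => r _.
  rewrite /qap (reindex_inj (@perm_inj _ r)) /=.
  under eq_bigr => i _ do rewrite (reindex_inj (@perm_inj _ r)) /=.
  over.
rewrite exchange_big; apply: eq_bigr => i _; rewrite exchange_big; apply: eq_bigr => j _.
by apply: eq_bigr => r _; rewrite !permJ.
Qed.

Lemma natr_cardE (T : finType) (D : {set T}) : #|D|%:R = \sum_x (x \in D)%:R :> R.
Proof. by rewrite -sum1_card natr_sum big_mkcond; apply: eq_bigr => x _; case: (x \in D). Qed.

Lemma sum_indicator (x : 'I_n) (F : 'I_n -> R) : \sum_j (x == j)%:R * F j = F x.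
Proof.
rewrite (bigD1 x) //= eqxx mul1r big1 ?addr0 // => j jx.
by rewrite eq_sym (negbTE jx) mul0r.
Qed.

Lemma sum_linear (F1 F2 F3 F4 : 'I_n -> R) (a b c d e : R) :
  \sum_i (a + b * F1 i + c * F2 i + d * F3 i + e * F4 i) = n%:R * a +
  b * (\sum_i F1 i) + c * (\sum_i F2 i) + d * (\sum_i F3 i) + e * (\sum_i F4 i).
Proof. by rewrite !big_split -!mulr_sumr /= sumr_const card_ord mulr_natl. Qed.

(** Summing [sym_sumE] at p = s i, q = s j leaves only sums determined by the k fixed points of [s]
    and the k + c fixed points of its square. *)
Lemma sum_sym_sum_cycle_class k c s : s \in cycle_class _ k c ->
  let N : R := n%:R ^+ 2 - 3 * n%:R + 1 in
  let K : R := k%:R ^+ 2 - 3 * k%:R + 1 in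
  (n%:R - 2) * ((n%:R - 3) * \sum_(r : 'S_n) qap A B (s ^ r)%g) =
  same_sum * (N * K - 1 + c%:R) + swap_sum * (N * c%:R - N + K).
Proof.
rewrite in_set => /andP[/eqP Fk /eqP Cc] N K; rewrite sum_qap_conj.
pose u i : R := (s i == i)%:R.
pose d i j : R := (s i == j)%:R.
have Su : \sum_i u i = k%:R.
  by rewrite -Fk natr_cardE; apply: eq_bigr => i _; rewrite inE.
have Sss : \sum_i d (s i) i = k%:R + c%:R.
  rewrite -Fk -Cc !natr_cardE -big_split; apply: eq_bigr => i _ /=.
  rewrite !inE /d; case: (eqVneq (s i) i) => [E|_] /=; last by rewrite add0r.
  by rewrite !E eqxx addr0.
have Sd i : \sum_j d i j = 1.
  rewrite -[RHS](sum_indicator (s i) (fun=> 1)); apply: eq_bigr => j _; by rewrite mulr1.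
have Sd' j : \sum_i d i j = 1.
  rewrite (reindex_inj (@perm_inj _ s^-1%g)) -[RHS](sum_indicator j (fun=> 1)).
  by apply: eq_bigr => i _; rewrite mulr1 /d permKV eq_sym.
(* [X] extends the formula of [sym_sumE] to the diagonal, where [sym_sum] vanishes; its diagonal
   values are therefore subtracted. *)
pose X i j := same_sum * (N * (u i * u j) - (n%:R - 2) * (u i + u j) - (d i j + d j i) + d i j * d j i + 1) +
  swap_sum * (N * (d i j * d j i) - (n%:R - 2) * (d i j + d j i) - (u i + u j) + u i * u j + 1).
have XE i j : (n%:R - 2) * ((n%:R - 3) * sym_sum i j (s i) (s j)) =
    X i j - (i == j)%:R * X i j.
  case: (eqVneq i j) => [<-|ij]; first (rewrite sym_sum_diag !mulr0 mul1r subrr //).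
  by rewrite sym_sumE ?(inj_eq perm_inj) // /= mul0r subr0.
have dd i : \sum_j d i j * d j i = d (s i) i by rewrite sum_indicator.
have SX i : \sum_j X i j = same_sum * (N * (u i * k%:R) - (n%:R - 2) * (n%:R * u i + k%:R) - 2
    + d (s i) i + n%:R) + swap_sum * (N * d (s i) i - (n%:R - 2) * 2 - (n%:R * u i + k%:R)
    + u i * k%:R + n%:R).
  pose a := same_sum * (1 - (n%:R - 2) * u i) + swap_sum * (1 - u i).
  pose b := same_sum * (N * u i - (n%:R - 2)) + swap_sum * (u i - 1).
  pose e := - same_sum - swap_sum * (n%:R - 2).
  rewrite (eq_bigr (fun j => a + b * u j + e * d i j + e * d j i
      + (same_sum + swap_sum * N) * (d i j * d j i))) => [|j _]; last by rewrite /X /a /b /e; ring.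
  by rewrite sum_linear Su Sd Sd' dd /a /b /e; ring.
have Xii i : X i i = same_sum * (1 + (N - 2 * n%:R + 3) * u i) + swap_sum * (1 + (N - 2 * n%:R + 3) * u i).
  by rewrite /X /d -/(u i) /u; case: (s i == i) => /=; ring.
rewrite !mulr_sumr.
have S1 i : (n%:R - 2) * ((n%:R - 3) * \sum_j sym_sum i j (s i) (s j)) = \sum_j X i j - X i i.
  by rewrite !mulr_sumr (eq_bigr _ (fun j _ => XE i j)) sumrB sum_indicator.
rewrite (eq_bigr _ (fun i _ => S1 i)).
pose a := same_sum * (n%:R - 3 - (n%:R - 2) * k%:R) + swap_sum * (n%:R - 1 - (n%:R - 2) * 2 - k%:R).
pose b := same_sum * (N * k%:R - (n%:R - 2) * n%:R - (N - 2 * n%:R + 3)) +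
  swap_sum * (k%:R - n%:R - (N - 2 * n%:R + 3)).
(* The terms [0 * 0] only pad the summand to the shape of [sum_linear]. *)
rewrite (eq_bigr (fun i => a + b * u i + (same_sum + swap_sum * N) * d (s i) i + 0 * 0 + 0 * 0)) => [|i _]; last first.
  by rewrite SX Xii /a /b; ring.
by rewrite sum_linear Su Sss !sumr_const card_ord mul0rn /a /b /N /K; ring.
Qed.

(** Summed over [s], the entry [B (s i) (s j)] is the same for all i != j, so it factors out of the
    sum of the entries of A, which is 0. *)
Lemma sum_qap : \sum_(s : 'S_n) qap A B s = 0.
Proof.
have -> : \sum_(s : 'S_n) qap A B s = \sum_(s : 'S_n) \sum_i \sum_j B (s i0) (s j0) * A i j.
  rewrite exchange_big [RHS]exchange_big; apply: eq_bigr => i _ /=.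
  rewrite exchange_big [RHS]exchange_big; apply: eq_bigr => j _ /=.
  case: (eqVneq i j) => [<-|ij]; first by rewrite !big1 // => s _; rewrite A_diag mulr0.
  rewrite -!mulr_suml; congr (_ * _); have [s [<- <-]] := two_transitive ij0 ij.
  by rewrite [RHS](reindex_inj (mulgI s)); apply: eq_bigr => r _; rewrite !permM.
rewrite big1 // => s _; rewrite big1 // => i _.
by rewrite -mulr_sumr A_row mulr0.
Qed.

(** The identity is its own conjugacy class, and each ordered pair i != j contributes [same_sum]. *)
Lemma qap1_same_sum : n`!%:R * qap A B 1%g = n%:R * (n%:R - 1) * same_sum.
Proof.
have <- : \sum_(r : 'S_n) qap A B (1 ^ r)%g = n`!%:R * qap A B 1%g.
  under eq_bigr do rewrite conj1g.
  rewrite mulr_natl sumr_const -card_Sn; congr (_ *+ _); apply: eq_card => r; by rewrite !inE.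
rewrite sum_qap_conj.
under eq_bigr => i _.
  under eq_bigr => j _.
    have -> : sym_sum i j ((1%g : 'S_n) i) ((1%g : 'S_n) j) = same_sum - (i == j)%:R * same_sum.
      by rewrite !perm1; case: (eqVneq i j) => [<-|/sym_sum_eq->]; rewrite ?sym_sum_diag /=; ring.
    over.
  rewrite sumrB sum_indicator sumr_const card_ord; over.
by rewrite sumr_const card_ord -[LHS]mulr_natl -[same_sum *+ n]mulr_natl; ring.
Qed.

End Symmetrization.

(** * The mixture of two cycle classes and the tail bound when the maximum is at 1 *)

Lemma sum_cycle_class_conj (R : realType) (n k c : nat) (f : 'S_n -> R) :
  n`!%:R * \sum_(s in cycle_class _ k c) f s =
  \sum_(s in cycle_class _ k c) \sum_(r : 'S_n) f (s ^ r)%g.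
Proof.
rewrite exchange_big mulr_natl /= [RHS](eq_bigr (fun=> \sum_(s in cycle_class _ k c) f s)).
  by rewrite sumr_const -card_Sn; congr (_ *+ _); apply: eq_card.
move=> r _; rewrite [RHS](reindex_inj (conjg_inj r)) /=.
by apply: eq_bigl => s; rewrite cycle_classJ.
Qed.

(** Markov-type estimate: a term is below [t] outside the event and at most [M] on it. *)
Lemma sum_le_threshold (R : realType) (T : finType) (D : {set T}) (f : T -> R) (M t : R) :
  (forall x, f x <= M) ->
  \sum_(x in D) f x <= #|D|%:R * t + (M - t) * #|D :&: [set x | t <= f x]|%:R.
Proof.
move=> fM; rewrite -2!sum1_card !natr_sum mulr_suml mulr_sumr.
under [X in _ + X]eq_bigl do rewrite in_setI.
rewrite big_mkcondr -big_split; apply: ler_sum => x xD /=.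
by rewrite inE; have := fM x; case: (leP t (f x)) => /= *; lra.
Qed.

Section Core.
Variables (R : realType) (n k : nat) (A B : 'M[R]_n).
Hypotheses (A_diag : forall i, A i i = 0) (A_row : forall i, \sum_j A i j = 0)
  (A_col : forall j, \sum_i A i j = 0).
Hypotheses (k3 : (3 <= k)%N) (kn : (k + 5 <= n)%N).
Let bet := beta R n k.

Lemma beta_bounds : 0 < bet <= 1.
Proof.
have k3R : 3 <= k%:R :> R by rewrite (ler_nat R 3).
have knR : k%:R + 5 <= n%:R :> R by rewrite -natrD ler_nat.
rewrite /bet /beta; have N0 : 0 < n%:R ^+ 2 - 3 * n%:R + 1 :> R by nra.
by rewrite ler_pdivrMr // divr_gt0 //=; nra.
Qed.

(** With c of mean 1 - K/N, the [swap_sum] coefficient N c - N + K averages to 0 and the [same_sum]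
    coefficient N K - 1 + c to (K/N)(N^2 - 1). *)
Lemma cycle_class_mixture :
  (1 - (1 - bet) / 2) * ((\sum_(s in cycle_class _ k 0) qap A B s) / #|cycle_class 'I_n k 0|%:R) +
  (1 - bet) / 2 * ((\sum_(s in cycle_class _ k 2) qap A B s) / #|cycle_class 'I_n k 2|%:R)
  = bet * qap A B 1%g.
Proof.
have n8 : (8 <= n)%N by lia.
have n8R : 8 <= n%:R :> R by rewrite (ler_nat R 8).
pose i0 : 'I_n := Ordinal (leq_trans (isT : 0 < 8)%N n8).
pose j0 : 'I_n := Ordinal (leq_trans (isT : 1 < 8)%N n8).
have ij : i0 != j0 by [].
pose N : R := n%:R ^+ 2 - 3 * n%:R + 1.
pose K : R := k%:R ^+ 2 - 3 * k%:R + 1.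
have N0 : N != 0 by rewrite /N gt_eqF //; nra.
have betE : bet = K / N by [].
have f0 : n`!%:R != 0 :> R by rewrite pnatr_eq0 -lt0n fact_gt0.
have mean c : (0 < #|cycle_class 'I_n k c|)%N ->
    (n%:R - 2) * (n%:R - 3) * n`!%:R *
     ((\sum_(s in cycle_class _ k c) qap A B s) / #|cycle_class 'I_n k c|%:R) =
    same_sum A B i0 j0 * (N * K - 1 + c%:R) + swap_sum A B i0 j0 * (N * c%:R - N + K).
  move=> X0; rewrite mulrA -[_ * n`!%:R * _]mulrA sum_cycle_class_conj mulr_sumr.
  rewrite (eq_bigr _ (fun s sX => etrans (esym (mulrA _ _ _)) (sum_sym_sum_cycle_class B A_diag A_row A_col ij sX))).
  by rewrite sumr_const -[X in X / _]mulr_natl mulrAC divff ?mul1r // pnatr_eq0 -lt0n.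
have X0 : (0 < #|cycle_class 'I_n k 0|)%N.
  have := @card_cycle_class0_ge 'I_n k; rewrite card_ord => /(_ kn).
  by case: #|_| => //; rewrite muln0 leqn0 => /eqP E; have := fact_gt0 n; rewrite E.
have X2 : (0 < #|cycle_class 'I_n k 2|)%N.
  have := @card_cycle_class2_ge 'I_n k; rewrite card_ord => /(_ kn).
  by case: #|_| => //; rewrite muln0 leqn0 => /eqP E; have := fact_gt0 n; rewrite E.
have m0 := mean _ X0; have m2 := mean _ X2.
have q1 := qap1_same_sum B A_diag ij.
have C0 : (n%:R - 2) * (n%:R - 3) * n`!%:R != 0 :> R.
  by rewrite !mulf_neq0 // gt_eqF //; lra.
apply: (mulfI C0); move: m0 m2; set C := _ * _ * n`!%:R => m0 m2.
rewrite mulrDr ![C * (_ * (_ / _))]mulrCA m0 m2 mulrCA /C -[_ * n`!%:R * _]mulrA q1 betE.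
(* Indeed n(n-3) = N - 1 and (n-1)(n-2) = N + 1. *)
have NE : (n%:R - 2) * (n%:R - 3) * (n%:R * (n%:R - 1) * same_sum A B i0 j0) = (N ^+ 2 - 1) * same_sum A B i0 j0.
  by rewrite /N; ring.
by rewrite NE; field.
Qed.

(* Here d is the weight of the class in the mixture and e bounds the density. *)
Lemma mean_le_threshold c (d e M t : R) : 0 <= d ->
  (forall s, qap A B s <= M) -> t <= M ->
  (0 < #|cycle_class 'I_n k c|)%N -> d <= e * #|cycle_class 'I_n k c|%:R ->
  d * ((\sum_(s in cycle_class _ k c) qap A B s) / #|cycle_class 'I_n k c|%:R) <=
  d * t + (M - t) * e * #|cycle_class _ k c :&: [set s | t <= qap A B s]|%:R.
Proof.
move=> d0 fM tM X0 de; set X := cycle_class 'I_n k c in X0 de *.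
have Xp : 0 < #|X|%:R :> R by rewrite ltr0n.
have := sum_le_threshold X t fM; set S := \sum_(s in X) _; set G := #|_ :&: _|%:R => SG.
rewrite mulrA ler_pdivrMr //.
have h1 : d * S <= d * (#|X|%:R * t + (M - t) * G) by rewrite ler_wpM2l.
have h2 : d * ((M - t) * G) <= e * #|X|%:R * ((M - t) * G).
  by rewrite ler_wpM2r // mulr_ge0 ?ler0n // subr_ge0.
lra.
Qed.

Lemma max_at_one_tail (gamma : R) : 0 < gamma -> gamma < 1 ->
  (forall s, qap A B s <= qap A B 1%g) ->
  (1 - gamma) * bet * n`!%:R <=
  10 * k`!%:R * #|[set s : 'S_n | gamma * bet * qap A B 1%g <= qap A B s]|%:R.
Proof.
move=> g0 g1 fM; set M := qap A B 1%g in fM *; set t := gamma * bet * M; set G := [set s | _].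
have /andP[b0 b1] := beta_bounds.
have f0 : 0 < n`!%:R :> R by rewrite ltr0n fact_gt0.
have kf : 1 <= k`!%:R :> R by rewrite (ler_nat R 1) fact_gt0.
have n8 : (8 <= n)%N by lia.
pose i0 : 'I_n := Ordinal (leq_trans (isT : 0 < 8)%N n8).
pose j0 : 'I_n := Ordinal (leq_trans (isT : 1 < 8)%N n8).
have ij : i0 != j0 by [].
have sum0 := sum_qap B A_diag A_row ij.
have M0 : 0 <= M.
  have : \sum_(s : 'S_n) qap A B s <= \sum_(s : 'S_n) M by apply: ler_sum.
  by rewrite sum0 sumr_const pmulrn_lge0 // card_Sn fact_gt0.
(* If the maximum is 0, then f, having sum 0, vanishes identically and the event is certain. *)
have [M1|M1] := eqVneq M 0.
  have fs s : qap A B s = 0.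
    have : \sum_(s : 'S_n) - qap A B s = 0 by rewrite sumrN sum0 oppr0.
    move/psumr_eq0P => /(_ _ s isT) h; apply: oppr_inj; rewrite oppr0 h // => r _.
    by rewrite oppr_ge0 -M1.
  have -> : G = setT by apply/setP => s; rewrite !inE /t M1 mulr0 fs lexx.
  rewrite cardsT card_Sn ler_wpM2r 1?ltW //; nra.
have {M1}M0 : 0 < M by rewrite lt_def M1 M0.
have gb : gamma * bet <= 1 by apply: mulr_ile1 => //; apply: ltW.
have tM : t <= M by rewrite /t ler_piMl // ltW.
have mix := cycle_class_mixture.
pose D : R := 10 * k`!%:R / n`!%:R.
have C0 : n`!%:R <= 10 * k`!%:R * #|cycle_class 'I_n k 0|%:R :> R.
  by rewrite -!natrM ler_nat -[n in n`!]card_ord card_cycle_class0_ge // card_ord.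
have C2 : n`!%:R <= 20 * k`!%:R * #|cycle_class 'I_n k 2|%:R :> R.
  by rewrite -!natrM ler_nat -[n in n`!]card_ord card_cycle_class2_ge // card_ord.
have X0 : (0 < #|cycle_class 'I_n k 0|)%N.
  by rewrite lt0n; apply/eqP => E; move: C0; rewrite E mulr0 leNgt f0.
have X2 : (0 < #|cycle_class 'I_n k 2|)%N.
  by rewrite lt0n; apply/eqP => E; move: C2; rewrite E mulr0 leNgt f0.
have m0 := @mean_le_threshold 0 (1 - (1 - bet) / 2) D M t _ fM tM X0 _.
have m2 := @mean_le_threshold 2 ((1 - bet) / 2) D M t _ fM tM X2 _.
(* The common density [D] works for both classes: weight at most 1 against the constant 10, weight
   at most 1/2 against 20. *)
have {}m0 := m0 ltac:(lra) ltac:(rewrite /D mulrAC ler_pdivlMr //; nra).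
have {}m2 := m2 ltac:(lra) ltac:(rewrite /D mulrAC ler_pdivlMr //; nra).
have GG : #|cycle_class _ k 0 :&: G|%:R + #|cycle_class _ k 2 :&: G|%:R <= #|G|%:R :> R.
  rewrite -natrD ler_nat -cardsUI -[X in (_ <= X)%N]addn0 leq_add //.
    by rewrite subset_leq_card // -setIUl subsetIr.
  rewrite leqn0 cards_eq0; apply/eqP/setP => s; rewrite in_set0 !in_setI !in_set.
  by case: (#|two_cycle_points s| =P 0%N) => [->|]; rewrite ?andbF.
have D0 : 0 < D by rewrite /D divr_gt0 //; lra.
have h : bet * M <= t + (M - t) * D * #|G|%:R.
  have h3 : (M - t) * D * (#|cycle_class _ k 0 :&: G|%:R + #|cycle_class _ k 2 :&: G|%:R)
     <= (M - t) * D * #|G|%:R.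
    by rewrite ler_wpM2l // mulr_ge0 ?subr_ge0 // ltW.
  rewrite -/M in mix; lra.
have DG : 0 <= D * #|G|%:R by rewrite mulr_ge0 ?ler0n // ltW.
(* Since t >= 0, the factor M - t may be enlarged to M, which then cancels. *)
have {}h : M * ((1 - gamma) * bet) <= M * (D * #|G|%:R).
  have t0 : 0 <= t by rewrite /t -mulrA pmulr_rge0 // pmulr_rge0 // ltW.
  have h4 : 0 <= t * (D * #|G|%:R) by exact: mulr_ge0.
  by rewrite /t in h h4; lra.
rewrite ler_pM2l // /D mulrAC ler_pdivlMr // in h.
Qed.

End Core.

(** * Reduction to zero diagonal, zero line sums and a maximum at 1 *)

Theorem theorem3p1 (R : realType) (n : nat) (A B : 'M[R]_n)
    (hsums : constant_line_sums A) (hdiag : constant_diagonal A)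
    (tau : 'S_n)
    (htau : forall sigma : 'S_n,
       centered (qap A B) sigma <= centered (qap A B) tau)
    (k : nat) (hk3 : (3 <= k)%N) (hkn : (k + 5 <= n)%N)
    (gamma : R) (hgamma0 : 0 < gamma) (hgamma1 : gamma < 1) :
  (1 - gamma) * beta R n k / (10 * k`!%:R) <=
  perm_prob R (fun sigma : 'S_n =>
    gamma * beta R n k * centered (qap A B) tau <= centered (qap A B) sigma).
Proof.
have [a [Acol Arow]] := hsums; have [b Adiag] := hdiag.
have n8R : 8 <= n%:R :> R by rewrite (ler_nat R 8); lia.
have n8 : (8 <= n)%N by lia.
pose i0 : 'I_n := Ordinal (leq_trans (isT : 0 < 8)%N n8).
pose j0 : 'I_n := Ordinal (leq_trans (isT : 1 < 8)%N n8).
have ij : i0 != j0 by [].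
(* [c] is the mean off-diagonal entry of a line; subtracting it off the diagonal and [b] on it makes
   diagonal and line sums vanish. *)
pose c := (a - b) / (n%:R - 1).
pose A0 : 'M[R]_n := \matrix_(i, j) (A i j - c - (i == j)%:R * (b - c)).
have A0diag i : A0 i i = 0 by rewrite mxE Adiag eqxx mul1r subrr.
have c0 : a - n%:R * c - (b - c) = 0 by rewrite /c; field; rewrite gt_eqF //; lra.
have A0row i : \sum_j A0 i j = 0.
  under eq_bigr do rewrite mxE.
  by rewrite !sumrB sum_indicator Arow sumr_const card_ord -mulr_natl.
have A0col j : \sum_i A0 i j = 0.
  under eq_bigr do rewrite mxE eq_sym.
  by rewrite !sumrB sum_indicator Acol sumr_const card_ord -mulr_natl.
have qapE s : qap A B s = qap A0 B s + ((\sum_i \sum_j B i j) * c + (\sum_i B i i) * (b - c)).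
  rewrite (reindex_inj (@perm_inj _ s)) [X in _ + (_ + X * _)](reindex_inj (@perm_inj _ s)) /=.
  rewrite !mulr_suml -!big_split; apply: eq_bigr => i _ /=.
  have -> : \sum_j B (s i) j = \sum_j B (s i) (s j) by exact: (reindex_inj perm_inj).
  rewrite mulr_suml addrA -big_split /=.
  rewrite -(sum_indicator i (fun j => B (s i) (s j) * (b - c))) -big_split.
  by apply: eq_bigr => j _ /=; rewrite mxE; ring.
have fact0 : n`!%:R != 0 :> R by rewrite pnatr_eq0 -lt0n fact_gt0.
have centE s : centered (qap A B) s = qap A0 B s.
  rewrite /centered /perm_mean (eq_bigr _ (fun s _ => qapE s)) big_split /=.
  rewrite (sum_qap B A0diag A0row ij) sumr_const card_Sn add0r -[X in _ * X]mulr_natl.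
  by rewrite mulrA mulVf // mul1r qapE addrK.
(* Relabelling B by [tau] turns f(s) into f(s tau), which moves the maximum to 1. *)
pose B' : 'M[R]_n := \matrix_(i, j) B (tau i) (tau j).
have B'E s : qap A0 B' s = qap A0 B (s * tau)%g.
  by apply: eq_bigr => i _; apply: eq_bigr => j _; rewrite mxE !permM.
have B'1 : qap A0 B' 1%g = qap A0 B tau by rewrite B'E mul1g.
have fM s : qap A0 B' s <= qap A0 B' 1%g by rewrite B'1 B'E -!centE.
have := max_at_one_tail A0diag A0row A0col hk3 hkn hgamma0 hgamma1 fM; rewrite B'1.
set G := #|_|; rewrite /perm_prob centE card_Sn; set H := #|_| => tail.
(* Right multiplication by [tau] carries the event for [B'] injectively into the one for B. *)
have GH : (G <= H)%N.
  by apply: (card_mulr_le (c := tau)) => s; rewrite !inE centE B'E.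
have k0 : 0 < 10 * k`!%:R :> R by rewrite mulr_gt0 // ltr0n fact_gt0.
have f0 : 0 < n`!%:R :> R by rewrite ltr0n fact_gt0.
rewrite ler_pdivrMr // mulrAC ler_pdivlMr // (le_trans tail) // [leRHS]mulrC.
by rewrite ler_wpM2l ?ler_nat // ltW.
Qed.
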